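(* Let $(X,d)$ be a complete separable metric space with a random walk $\{m_x\}_{x\in X}$, and let $\kappa\in\mathbb{R}$ be a constant such that the coarse Ricci curvature associated with $\{m_x\}_{x\in X}$ satisfies $\kappa(x,y)\ge\kappa$ for all $x,y\in X$ with $x\neq y$. Then the following hold. (1) If there exists a nonconstant Lipschitz function $f:X\to\mathbb{R}$ such that $\Delta f=\lambda f$ for a real number $\lambda$, then $\kappa\le\lambda\le 2-\kappa$. (2) If $\kappa>0$ and a Lipschitz function $f:X\to\mathbb{R}$ satisfies $\Delta f=0$, then $f$ is a constant function.
   Context: Let $\mathcal{P}_1(X)$ be the set of Borel probability measures $\mu$ on $X$ with finite first moment, i.e. $\int_X d(x,o)\,d\mu(x)<\infty$ for a point $o\in X$. The $L^1$-Wasserstein metric on $\mathcal{P}_1(X)$ is $W_1(\mu,\mu')=\inf_{\xi}\int_{X\times X}d(x,y)\,d\xi(x,y)$, the infimum being over all couplings $\xi$ of $\mu$ and $\mu'$. A random walk on $X$ is a family $\{m_x\}_{x\in X}$ of Borel probability measures such that $x\mapsto m_x$ is a Borel measurable map from $(X,d)$ to $(\mathcal{P}_1(X),W_1)$. The associated coarse Ricci curvature is $\kappa(x,y)=1-\frac{W_1(m_x,m_y)}{d(x,y)}$ for distinct $x,y\in X$. The Laplacian of $f:X\to\mathbb{R}$ is $\Delta f(x)=f(x)-\int_X f(y)\,dm_x(y)$, whenever the right-hand side is defined. *)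

(* Defs.v *)
From HB Require Import structures.
From mathcomp Require Import all_boot all_order all_algebra.
From mathcomp Require Import all_classical all_reals all_analysis.

Set Implicit Arguments.
Unset Strict Implicit.
Unset Printing Implicit Defensive.

Import Order.TTheory GRing.Theory Num.Theory.
Import numFieldNormedType.Exports.

Local Open Scope classical_set_scope.
Local Open Scope ring_scope.

(* [Complete] carries a distinguished point, hence the space is nonempty. *)
#[short(type="completeMetricType")]
HB.structure Definition CompleteMetric (K : numDomainType) :=
  {T of Metric K T & Complete T}.

(* Declares [X * Y] as a [ptopologicalType]; the library provides the pointed
   and the topological structures but not their join. *)
HB.instance Definition _ (X Y : ptopologicalType) := Pointed.on (X * Y)%type.

Definition separable (T : topologicalType) : Prop :=
  exists2 D : set T, countable D & dense D.

Definition borel (T : ptopologicalType) : measurableType (@open T).-sigma :=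
  g_sigma_algebraType (@open T).

Section wasserstein.
Context {R : realType} (X : completeMetricType R).

Local Open Scope ereal_scope.

Record P1 := {
  P1_probability :> probability (borel X) R ;
  P1_first_moment :
    exists o : X, \int[P1_probability]_x (mdist x o)%:E < +oo }.

(* Couplings live on the Borel sets of the topological product [X * X]. *)
Definition coupling (mu nu : probability (borel X) R)
    (xi : probability (borel (X * X)%type) R) : Prop :=
  forall A : set (borel X), measurable A ->
    xi (A `*` setT) = mu A /\ xi (setT `*` A) = nu A.

Definition W1 (mu nu : P1) : \bar R :=
  ereal_inf [set \int[xi]_p (mdist p.1 p.2)%:E | xi in coupling mu nu].

Definition W1_open : set (set P1) :=
  [set U | forall mu, U mu ->
     exists2 e : R, (0 < e)%R & [set nu | W1 mu nu < e%:E] `<=` U].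

Definition random_walk (m : X -> P1) : Prop :=
  forall B : set P1, <<s W1_open >> B ->
    measurable (m @^-1` B : set (borel X)).

(* [W1] is finite on [P1], so this is a real number whenever [x != y]. *)
Definition coarse_ricci (m : X -> P1) (x y : X) : \bar R :=
  1 - W1 (m x) (m y) / (mdist x y)%:E.

(* The integral is the intended one when [f] is [m x]-integrable, which is
   the case for every Lipschitz [f] since [m x] has finite first moment. *)
Definition laplacian (m : X -> P1) (f : X -> R) (x : X) : R :=
  (f x - \int[m x]_y f y)%R.

End wasserstein.

(* The Lipschitz predicates of the library require normed modules. *)
Definition lipschitz_fun {R : realType} (X : metricType R) (f : X -> R) : Prop :=
  exists L : R, forall x y : X, `|f x - f y| <= L * mdist x y.

Definition constant_fun (S T : Type) (f : S -> T) : Prop :=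
  exists c : T, forall x : S, f x = c.

(* Main.v *)
Require Import Defs.
From HB Require Import structures.
From mathcomp Require Import all_boot all_order all_algebra.
From mathcomp Require Import all_classical all_reals all_analysis.
From mathcomp Require Import measurable_realfun lra.

(* Let M f (x) be the mean of f with respect to m x.  If f is L-Lipschitz then
   |M f (x) - M f (y)| <= L W1(m x, m y) <= (1 - kappa) L d(x, y), since any
   coupling of m x and m y gives the difference of means as the integral of
   f(p.1) - f(p.2).  When f is an eigenfunction, M f = (1 - lambda) f; applying
   this with L the optimal Lipschitz constant of f, which is positive for f
   nonconstant, yields |1 - lambda| L <= (1 - kappa) L. *)

Set Implicit Arguments.
Unset Strict Implicit.
Unset Printing Implicit Defensive.

Import Order.TTheory GRing.Theory Num.Theory.
Import numFieldNormedType.Exports.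

Local Open Scope classical_set_scope.
Local Open Scope ring_scope.

Lemma continuous_borel_measurable (R : realType) (T : ptopologicalType)
    (f : T -> R) :
  continuous f -> measurable_fun [set: borel T] f.
Proof.
move=> /continuousP cf.
apply: (measurability _ (RGenOpens.measurableE R)).
move=> _ [_ [a [b ->]] <-]; rewrite setTI; apply: sub_sigma_algebra.
by apply: cf; exact: interval_open.
Qed.

Lemma continuous_borel_borel_measurable (T U : ptopologicalType) (f : T -> U) :
  continuous f -> measurable_fun [set: borel T] (f : borel T -> borel U).
Proof.
move=> /continuousP cf.
apply: (@measurability _ _ (borel T) (borel U) _ _ (@open U)) => //.
by move=> _ [B oB <-]; rewrite setTI; apply: sub_sigma_algebra; exact: cf.
Qed.

Section lipschitz_functions.
Context {R : realType}.

Lemma ler_dist_mdist (X : metricType R) (o x y : X) :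
  `|mdist x o - mdist y o| <= mdist x y.
Proof.
have := metric_triangle x y o; have := metric_triangle y x o.
rewrite (metric_sym y x) => *; rewrite ler_norml; lra.
Qed.

Lemma lipschitz_continuous (X : metricType R) (L : R) (f : X -> R) :
  (forall x y, `|f x - f y| <= L * mdist x y) -> continuous f.
Proof.
move=> fL x; apply/cvgrPdist_lt => e e0.
(* [L] may be zero or negative, so the radius is [e / (|L| + 1)] rather than [e / L]. *)
have K0 : 0 < `|L| + 1 by rewrite ltr_pwDr.
near=> y.
apply: (le_lt_trans (fL x y)).
have : mdist x y < e / (`|L| + 1).
  near: y; apply: (metricType_numDomainType.cvgr_dist_lt cvg_id).
  by rewrite divr_gt0.
rewrite ltr_pdivlMr// mulrC; apply: le_lt_trans.
rewrite ler_wpM2r ?mdist_ge0//.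
by rewrite (le_trans (ler_norm L))// lerDl.
Unshelve. all: by end_near. Qed.

Lemma mdist_continuous (X : metricType R) :
  continuous (fun p : X * X => mdist p.1 p.2).
Proof.
move=> [a b]; apply/cvgrPdist_lt => /= e e0.
have e2 : 0 < e / 2 by rewrite divr_gt0.
near=> p.
have pa : mdist a p.1 < e / 2.
  by near: p; apply: (metricType_numDomainType.cvgr_dist_lt cvg_fst).
have pb : mdist b p.2 < e / 2.
  by near: p; apply: (metricType_numDomainType.cvgr_dist_lt cvg_snd).
(* Move one endpoint at a time, passing through the distance from [p.1] to [b]; each move costs less
   than [e / 2]. *)
have := ler_dist_mdist b a p.1; have := ler_dist_mdist p.1 b p.2.
rewrite (metric_sym b p.1) (metric_sym p.2 p.1) => /ler_normlP[? ?].
by move=> /ler_normlP[? ?]; rewrite ltr_norml; lra.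
Unshelve. all: by end_near. Qed.

(** With [z] a point of finite first moment, [|f x|] is dominated by [|f z| + L * mdist x z], which
    is integrable because [mu] is finite. *)
Lemma lipschitz_integrable (X : completeMetricType R) (mu : P1 X) (L : R)
    (f : X -> R) :
  (forall x y, `|f x - f y| <= L * mdist x y) ->
  mu.-integrable [set: borel X] (EFin \o f).
Proof.
move=> fL.
have [z mz] := P1_first_moment mu.
have md : measurable_fun [set: borel X] (fun x : borel X => mdist (x : X) z).
  apply: continuous_borel_measurable.
  apply: (@lipschitz_continuous _ 1) => x y.
  by rewrite mul1r; exact: ler_dist_mdist.
have mf : measurable_fun [set: borel X] f.
  by apply: continuous_borel_measurable; exact: lipschitz_continuous fL.
have intd : mu.-integrable [set: borel X] (EFin \o (fun x => mdist (x : X) z)).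
  apply/integrableP; split; first exact/measurable_EFinP.
  under eq_integral do rewrite /= ger0_norm ?mdist_ge0//.
  exact: mz.
have ic : mu.-integrable [set: borel X] (EFin \o cst `|f z|).
  exact: finite_measure_integrable_cst.
apply: (le_integrable measurableT _ _
  (integrableD measurableT ic (integrableZl measurableT L intd))).
  exact/measurable_EFinP.
move=> x _ /=; rewrite lee_fin.
rewrite (le_trans _ (ler_norm _))//.
rewrite -lerBlDl (le_trans _ (fL x z))// (le_trans (lerB_dist _ _))//.
Qed.

Section marginal.
Context d d' (T : measurableType d) (U : measurableType d').
Variables (mu : {measure set U -> \bar R}) (xi : {measure set T -> \bar R}).
Variable phi : T -> U.
Hypothesis mphi : measurable_fun [set: T] phi.
Hypothesis xi_phi : forall A, measurable A -> xi (phi @^-1` A) = mu A.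
Variable f : U -> R.
Hypothesis intf : mu.-integrable [set: U] (EFin \o f).

Let mf : measurable_fun [set: U] (EFin \o f) := measurable_int _ intf.

(** The pushforward of [xi] along [phi] agrees with [mu] on measurable sets, so the change of
    variables for nonnegative functions applies to [|f|]. Later [xi] is a coupling and [phi] one of
    its two projections. *)
Lemma marginal_integrable : xi.-integrable [set: T] (EFin \o (f \o phi)).
Proof.
have /integrableP[_ foo] := intf.
apply/integrableP; split; first exact: measurableT_comp mf mphi.
rewrite -[ltLHS](ge0_integral_pushforward mphi xi measurableT
  (f := fun y => `|(f y)%:E|%E)) //; last exact: measurableT_comp.
by rewrite (eq_measure_integral mu)// => A mA _; exact: xi_phi.
Qed.

Lemma marginal_Rintegral : \int[xi]_t f (phi t) = \int[mu]_x f x.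
Proof.
rewrite /Rintegral; congr fine.
rewrite -[LHS](integral_pushforward mphi mf marginal_integrable measurableT).
by apply: eq_measure_integral => A mA _; exact: xi_phi.
Qed.

End marginal.

Section wasserstein.
Variable X : completeMetricType R.

Lemma W1_ge0 (mu nu : P1 X) : (0 <= W1 mu nu)%E.
Proof.
apply: le_ereal_inf_tmp => _ [xi _ <-].
by apply: integral_ge0 => p _; rewrite lee_fin mdist_ge0.
Qed.

(** This is the easy half of Kantorovich-Rubinstein duality. With [L^-1] on the left, the infimum
    defining [W1] is bounded below one coupling at a time. *)
Lemma lipschitz_Rintegral_le_W1 (mu nu : P1 X) (L : R) (f : X -> R) :
  0 < L -> (forall x y, `|f x - f y| <= L * mdist x y) ->
  ((L^-1 * `|\int[mu]_x f x - \int[nu]_x f x|)%:E <= W1 mu nu)%E.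
Proof.
move=> L0 fL; apply: le_ereal_inf_tmp => _ [xi muxi <-].
(* Couplings live on the Borel sets of the product topology, so the projections are measurable
   because they are continuous. *)
have mfst : measurable_fun [set: borel (X * X)%type]
    (fst : borel (X * X)%type -> borel X).
  by apply: continuous_borel_borel_measurable => p; exact: cvg_fst.
have msnd : measurable_fun [set: borel (X * X)%type]
    (snd : borel (X * X)%type -> borel X).
  by apply: continuous_borel_borel_measurable => p; exact: cvg_snd.
have xifst (A : set (borel X)) : measurable A -> xi (fst @^-1` A) = mu A.
  move=> mA; rewrite -(muxi A mA).1; congr (xi _).
  by apply/seteqP; split => [p //|p []].
have xisnd (A : set (borel X)) : measurable A -> xi (snd @^-1` A) = nu A.
  move=> mA; rewrite -(muxi A mA).2; congr (xi _).
  by apply/seteqP; split => [p //|p []].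
have int1 := marginal_integrable mfst xifst (lipschitz_integrable mu fL).
have int2 := marginal_integrable msnd xisnd (lipschitz_integrable nu fL).
rewrite -(marginal_Rintegral mfst xifst (lipschitz_integrable mu fL)).
rewrite -(marginal_Rintegral msnd xisnd (lipschitz_integrable nu fL)).
rewrite -RintegralB// EFinM lee_pdivrMl// -abse_EFin.
have int12 := integrableB measurableT int1 int2.
rewrite /Rintegral fineK; last exact: integrable_fin_num int12.
apply: le_trans (le_abse_integral _ measurableT (measurable_int _ int12)) _.
have md : measurable_fun [set: borel (X * X)%type]
    (fun p : borel (X * X)%type => (mdist (p : X * X).1 (p : X * X).2)%:E).
  apply/measurable_EFinP.
  exact: (@continuous_borel_measurable R (X * X)%type _ (@mdist_continuous X)).
rewrite -ge0_integralZl_EFin ?(ltW L0)//; last first.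
  by move=> p _; rewrite lee_fin mdist_ge0.
apply: ge0_le_integral => //.
- exact: measurableT_comp (measurable_int _ int12).
- exact: measurable_funeM.
- by move=> p _; rewrite -EFinM lee_fin fL.
Qed.

Lemma W1_le_curvature (m : X -> P1 X) (kappa : R) (x y : X) : x != y ->
  (kappa%:E <= coarse_ricci m x y)%E ->
  (W1 (m x) (m y) <= ((1 - kappa) * mdist x y)%:E)%E.
Proof.
rewrite -mdist_gt0 => d0; rewrite /coarse_ricci inver gt_eqF//.
have := W1_ge0 (m x) (m y).
(* An infinite [W1] would make the curvature [-oo], against the real lower bound [kappa]; so the
   curvature hypothesis itself gives finiteness. *)
case: (W1 _ _) => [w w0| |] //; last by rewrite gt0_mulye// lte_fin invr_gt0.
rewrite -EFinM -EFinB !lee_fin => h.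
rewrite -ler_pdivrMr//; lra.
Qed.

End wasserstein.

Lemma eigenvalue_bound (X : completeMetricType R) (m : X -> P1 X)
    (kappa lambda : R) (f : X -> R) :
  (forall x y : X, x != y -> (kappa%:E <= coarse_ricci m x y)%E) ->
  ~ constant_fun f -> lipschitz_fun f ->
  (forall x, laplacian m f x = lambda * f x) ->
  `|1 - lambda| <= 1 - kappa.
Proof.
move=> curv fNc [L0 fL0] lapf.
have [x [y fxy]] : exists x y, f x != f y.
  apply: contra_notP fNc => /forallNP nf; exists (f point) => x.
  by apply/eqP/negPn/negP => fx; apply: (nf x); exists point.
(* The optimal Lipschitz constant is [sup S], the supremum of the slopes over pairs of distinct
   points. *)
pose slope p := `|f p.1 - f p.2| / mdist p.1 p.2.
pose S := [set slope p | p in [set p : X * X | p.1 != p.2]].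
have xy : x != y by apply: contraNneq fxy => ->.
have Sxy : S (slope (x, y)) by exists (x, y).
have S_ub : has_ubound S.
  exists L0 => _ [[a b] /= ab <-].
  by rewrite ler_pdivrMr ?mdist_gt0.
have L_gt0 : 0 < sup S.
  apply: lt_le_trans (ub_le_sup S_ub Sxy).
  by rewrite divr_gt0 ?mdist_gt0// normr_gt0 subr_eq0.
have fL a b : `|f a - f b| <= sup S * mdist a b.
  have [->|ab] := eqVneq a b; first by rewrite subrr normr0 mdistxx mulr0.
  rewrite -ler_pdivrMr ?mdist_gt0//; apply: ub_le_sup => //.
  by exists (a, b).
have mean a : \int[m a]_z f z = (1 - lambda) * f a.
  by have := lapf a; rewrite /laplacian => h; lra.
rewrite -(ler_pM2r L_gt0).
(* The main argument divides by [|1 - lambda|]. When [lambda = 1], only [0 <= 1 - kappa] is needed,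
   and it follows from [W1] being nonnegative at two distinct points. *)
have [->|l1] := eqVneq (1 - lambda) 0.
  rewrite normr0 mul0r mulr_ge0 ?(ltW L_gt0)//.
  have := le_trans (W1_ge0 _ _) (W1_le_curvature xy (curv _ _ xy)).
  by rewrite lee_fin pmulr_lge0 ?mdist_gt0.
rewrite -ler_pdivlMl ?normr_gt0//.
(* It suffices to bound every single slope by [|1 - lambda|^-1 * ((1 - kappa) * sup S)]. *)
apply: ge_sup; first by exists (slope (x, y)).
move=> _ [[a b] /= ab <-].
rewrite ler_pdivlMl ?normr_gt0// mulrA ler_pdivrMr ?mdist_gt0//.
rewrite -normrM mulrBr -!mean.
have := le_trans (lipschitz_Rintegral_le_W1 (m a) (m b) L_gt0 fL)
  (W1_le_curvature ab (curv _ _ ab)).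
by rewrite lee_fin ler_pdivrMl// mulrCA mulrA.
Qed.

End lipschitz_functions.

Theorem theorem1p9 (R : realType) (X : completeMetricType R)
    (X_separable : separable X)
    (m : X -> P1 X) (m_walk : random_walk m)
    (kappa : R)
    (curvature_ge : forall x y : X, x != y ->
       (kappa%:E <= coarse_ricci m x y)%E) :
  (forall lambda : R,
     (exists f : X -> R,
        [/\ ~ constant_fun f, lipschitz_fun f &
            forall x : X, laplacian m f x = lambda * f x]) ->
     kappa <= lambda <= 2 - kappa) /\
  (0 < kappa ->
     forall f : X -> R, lipschitz_fun f ->
       (forall x : X, laplacian m f x = 0) -> constant_fun f).
Proof.
split=> [lambda [f [fNc fL lapf]]|kappa0 f fL lapf].
  have := eigenvalue_bound curvature_ge fNc fL lapf.
  by rewrite ler_norml => /andP[? ?]; apply/andP; split; lra.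
apply: contrapT => fNc.
(* A harmonic function is an eigenfunction for [lambda = 0]; were it nonconstant, the bound would
   read [1 <= 1 - kappa]. *)
have : `|1 - 0| <= 1 - kappa.
  by apply: eigenvalue_bound curvature_ge fNc fL _ => x; rewrite lapf mul0r.
by rewrite subr0 normr1; lra.
Qed.
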